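(* Let $G=(V,E)$ be a simple, connected, undirected graph on $n$ vertices with at least one edge and let $k\in\{1,\dots,n-1\}$. Then $G$ is upper $k$-conformally rigid if and only if $S_k(\mathbf{1})\,S_k^\circ(\mathbf{1})=|E|$.
   Context: $\mathbf{1}\in\mathbb{R}^E$ is the all-ones vector. For $w\in\mathbb{R}^E_{\ge 0}$, $\mathcal{L}(w)=\sum_{ab\in E}w_{ab}(e_a-e_b)(e_a-e_b)^T$ with eigenvalues $0=\lambda_1(w)\le\dots\le\lambda_n(w)$, and $S_k(w)$ is the sum of the $k$ largest among $\lambda_2(w),\dots,\lambda_n(w)$. The dual gauge is $S_k^\circ(y)=\max\{y^Tw: w\in\mathbb{R}^E_{\ge0},\ S_k(w)\le1\}$. With $\Delta_E=\{w\ge0:\mathbf{1}^Tw=|E|\}$, $G$ is upper $k$-conformally rigid if $S_k(\mathbf{1})\le S_k(w)$ for all $w\in\Delta_E$. *)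

(* Defs.v *)
From HB Require Import structures.
From mathcomp Require Import all_boot all_order all_algebra.
From mathcomp Require Import boolp classical_sets reals.
From mathcomp.real_closed Require Import complex.

Set Implicit Arguments.
Unset Strict Implicit.
Unset Printing Implicit Defensive.

Import Order.TTheory GRing.Theory Num.Theory.
Local Open Scope classical_set_scope.
Local Open Scope ring_scope.

Definition is_spectrum (R : realType) (n : nat) (A : 'M[R]_n) (s : seq R) :=
  sorted <=%R s /\ char_poly A = \prod_(x <- s) ('X - x%:P).

(* The eigenvalues of A with multiplicity, in nondecreasing order, so that the
   i-th smallest one is at position i.-1. The default [::] is irrelevant for
   symmetric A: see spectrumP. *)
Definition spectrum (R : realType) (n : nat) (A : 'M[R]_n) : seq R :=
  xget [::] [set s | is_spectrum A s].

Lemma spectrumP (R : realType) (n : nat) (A : 'M[R]_n) :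
  A^T = A -> is_spectrum A (spectrum A) /\ size (spectrum A) = n.
Proof.
move=> Asym.
have szP s : is_spectrum A s -> size s = n.
  case=> _ /(congr1 (fun p : {poly R} => size p)).
  by rewrite size_char_poly size_prod_XsubC => -[].
suff [s sP] : exists s, is_spectrum A s.
  have sP' : is_spectrum A (spectrum A) by apply: xgetPex; exists s.
  by split=> //; apply: szP.
pose toC : {rmorphism R -> R[i]} := real_complex R.
pose B : 'M[R[i]]_n := map_mx toC A.
have Bherm : B \is hermsymmx.
  apply: realsym_hermsym.
    by apply/is_hermitianmxP; rewrite expr0 scale1r map_mx_id // /B map_trmx Asym.
  by apply/mxOverP => i j; rewrite mxE; apply/complex_realP; exists (A i j).
have D_real i : spectral_diag B 0 i \is Num.real.
  by have /mxOverP := hermitian_spectral_diag_real Bherm; apply.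
pose s := [seq complex.Re (spectral_diag B 0 i) | i <- enum 'I_n].
exists (sort <=%R s); split; first exact: sort_le_sorted.
have -> : \prod_(x <- sort <=%R s) ('X - x%:P) = \prod_(x <- s) ('X - x%:P).
  by apply: perm_big; rewrite perm_sort.
apply: (map_poly_inj toC).
rewrite map_char_poly -/B rmorph_prod big_map big_enum /=.
have /orthomx_spectralP BE := hermitian_normalmx Bherm.
have Pu := spectral_unit B.
set P := spectralmx B in BE Pu; set D := spectral_diag B in BE D_real *.
transitivity (char_poly (diag_mx D)).
  have cE : char_poly_mx B =
      map_mx polyC (invmx P) *m char_poly_mx (diag_mx D) *m map_mx polyC P.
    rewrite /char_poly_mx mulmxBr mulmxBl -!map_mxM -BE; congr (_ - _).
    by rewrite mul_mx_scalar -scalemxAl -map_mxM mulVmx // map_mx1 scalemx1.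
  rewrite /char_poly cE !det_mulmx mulrAC -det_mulmx -map_mxM mulVmx //.
  by rewrite map_mx1 det1 mul1r.
rewrite char_poly_trig ?diag_mx_is_trig //.
apply: eq_bigr => i _; rewrite mxE eqxx mulr1n.
by rewrite rmorphB /= map_polyX map_polyC /= RRe_real.
Qed.

(* Each undirected edge ab appears once, as the pair (a, b) with a < b. *)
Definition edge (n : nat) (adj : rel 'I_n) :=
  {p : 'I_n * 'I_n | (p.1 < p.2)%N && adj p.1 p.2}.
HB.instance Definition _ (n : nat) (adj : rel 'I_n) := Finite.on (edge adj).

Section Graph.
Variables (R : realType) (n : nat) (adj : rel 'I_n).

Local Notation edge := (edge adj).
Implicit Types w y : {ffun edge -> R}.

Definition all_ones : {ffun edge -> R} := [ffun=> 1].

Definition nonneg w := forall p, 0 <= w p.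

Definition dotE y w : R := \sum_p y p * w p.

Definition laplacian w : 'M[R]_n :=
  \sum_(p : edge) let d : 'cV[R]_n :=
    delta_mx (val p).1 0 - delta_mx (val p).2 0 in
  w p *: (d *m d^T).

Lemma trmx_laplacian w : (laplacian w)^T = laplacian w.
Proof.
rewrite /laplacian raddf_sum; apply: eq_bigr => p _ /=.
by rewrite linearZ /= trmx_mul trmxK.
Qed.

(* [behead] discards lambda_1; the last k of lambda_2 <= ... <= lambda_n are
   the k largest. *)
Definition eigsum (k : nat) w : R :=
  \sum_(x <- drop (n.-1 - k) (behead (spectrum (laplacian w)))) x.

Definition is_max (A : set R) (m : R) := A m /\ ubound A m.

(* The maximum is a genuine one: an element of the set bounding it above
   (xget returns 0 if there is none). *)
Definition dual_gauge (k : nat) y : R :=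
  xget 0 [set m | is_max
    [set dotE y w | w in [set w | nonneg w /\ eigsum k w <= 1]] m].

Definition weight_simplex : set {ffun edge -> R} :=
  [set w | nonneg w /\ dotE all_ones w = #|{: edge}|%:R].

Definition upper_conformally_rigid (k : nat) :=
  forall w, weight_simplex w -> eigsum k all_ones <= eigsum k w.

End Graph.

Arguments all_ones R {n} adj.
Arguments upper_conformally_rigid R {n} adj k.

(* Main.v *)
(** The sum S_k of the top eigenvalues is positively homogeneous, and it is
    positive on nonzero w >= 0 because the trace of the Laplacian is twice the
    total weight. Rescaling therefore maps the slice [1^T w = |E|] to the slice
    [S_k(w) = 1], and minimizing S_k on the former amounts to maximizing 1^T w
    on the latter. The existence of the maximum never has to be proved
    separately: in one direction 1 / S_k(1) attains it, and in the other a
    missing maximum would make [dual_gauge] equal to 0. *)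

Require Import Defs.
From mathcomp Require Import all_boot all_order all_algebra.
From mathcomp Require Import reals.
From mathcomp Require Import boolp classical_sets.
From mathcomp Require Import zify.

Set Implicit Arguments.
Unset Strict Implicit.

Import Order.TTheory GRing.Theory Num.Theory.
Local Open Scope ring_scope.

(** The characteristic polynomial fixes the roots up to permutation, and sortedness fixes their
    order. *)
Lemma is_spectrum_inj (R : realType) n (A : 'M[R]_n) s t :
  is_spectrum A s -> is_spectrum A t -> s = t.
Proof.
move=> [s_sorted sE] [t_sorted tE].
apply: (sorted_eq le_trans le_anti s_sorted t_sorted).
by apply: prod_XsubC_eq; rewrite -sE tE.
Qed.

Lemma spectrum_eq (R : realType) n (A : 'M[R]_n) s :
  A^T = A -> is_spectrum A s -> spectrum A = s.
Proof. by move=> /spectrumP[sA _]; apply: is_spectrum_inj. Qed.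

(** Entrywise, [X - c A] is [c] times [X - A] with [c^-1 X] substituted for [X]; the determinant
    then pulls out [c ^+ n]. *)
Lemma char_poly_scale (F : fieldType) n (c : F) (A : 'M[F]_n) : c != 0 ->
  char_poly (c *: A) = c ^+ n *: (char_poly A \Po (c^-1 *: 'X)).
Proof.
move=> c0; rewrite /char_poly -det_map_mx -mul_polyC rmorphXn /= -detZ.
congr (\det _); apply/matrixP => i j; rewrite !mxE.
rewrite linearB /= linearMn /= comp_polyX comp_polyC mulrBr -polyCM.
by rewrite mulrnAr mul_polyC scalerA divff // scale1r.
Qed.

Lemma is_spectrum_scale (R : realType) n (c : R) (A : 'M[R]_n) s : 0 < c ->
  size s = n -> is_spectrum A s -> is_spectrum (c *: A) [seq c * x | x <- s].
Proof.
move=> c0 sz [s_sorted sE]; split.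
  by rewrite sorted_map; apply: sub_sorted s_sorted => x y; rewrite /= ler_pM2l.
rewrite char_poly_scale ?gt_eqF // sE big_map -sz rmorph_prod /=.
(* Since [size s = n], the factor [c ^+ n] supplies one [c] per root, turning [c^-1 X - x] into
   [X - c x]. *)
elim: s {s_sorted sE sz} => [|x s IH]; first by rewrite !big_nil expr0 scale1r.
rewrite !big_cons -IH exprS -scalerA scalerAr scalerAl; congr (_ * _).
rewrite comp_polyB comp_polyX comp_polyC scalerBr scalerA divff ?gt_eqF //.
by rewrite scale1r -mul_polyC -polyCM.
Qed.

Lemma eigsum_scale (R : realType) n (adj : rel 'I_n) k (c : R)
    (w : {ffun edge adj -> R}) : 0 < c ->
  eigsum k [ffun p => c * w p] = c * eigsum k w.
Proof.
move=> c0; rewrite /eigsum.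
have [sP sz] := spectrumP (trmx_laplacian w).
have LE : laplacian [ffun p => c * w p] = c *: laplacian w.
  by rewrite scaler_sumr; apply: eq_bigr => p _; rewrite /= ffunE scalerA.
have -> : spectrum (laplacian [ffun p => c * w p]) =
    [seq c * x | x <- spectrum (laplacian w)].
  apply: spectrum_eq; first exact: trmx_laplacian.
  by rewrite LE; apply: is_spectrum_scale.
by rewrite behead_map -map_drop big_map mulr_sumr.
Qed.

(** Both sides are minus the subleading coefficient of the characteristic polynomial; size 0 has no
    such coefficient and is treated apart. *)
Lemma sum_spectrum (R : realType) n (A : 'M[R]_n) :
  A^T = A -> \sum_(x <- spectrum A) x = \tr A.
Proof.
move=> /spectrumP[[_ sE] sz].
case: n A sE sz => [|n] A sE sz.
  by rewrite (size0nil sz) big_nil /mxtrace big_ord0.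
apply: oppr_inj; rewrite -char_poly_trace // sE.
have -> : n.+1.-1 = (size (spectrum A)).-1 by rewrite sz.
by rewrite coefPn_prod_XsubC ?sz.
Qed.

(** A row eigenvector [v] for [x] gives [v A v^T = x |v|^2], and [|v|^2 > 0]. *)
Lemma spectrum_ge0 (R : realType) n (A : 'M[R]_n) :
  A^T = A -> (forall v : 'rV[R]_n, 0 <= (v *m A *m v^T) 0 0) ->
  forall x, x \in spectrum A -> 0 <= x.
Proof.
move=> /spectrumP[[_ sE] _] Apsd x xs.
have /eigenvalueP[v vA v0] : eigenvalue A x.
  by rewrite eigenvalue_root_char sE root_prod_XsubC.
have := Apsd v; rewrite vA -scalemxAl mxE pmulr_lge0 //.
rewrite mxE; under eq_bigr do rewrite mxE -expr2.
rewrite lt_def sumr_ge0 ?andbT => [|i _]; last exact: sqr_ge0.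
apply: contraNN v0; rewrite psumr_eq0 => [/allP v0|i _]; last exact: sqr_ge0.
apply/eqP/rowP => i; rewrite mxE.
by have := v0 i (mem_index_enum _); rewrite /= sqrf_eq0 => /eqP.
Qed.

(** Each edge contributes its weight times the square of the scalar [v d]. *)
Lemma laplacian_psd (R : realType) n (adj : rel 'I_n)
    (w : {ffun edge adj -> R}) : nonneg w ->
  forall v : 'rV[R]_n, 0 <= (v *m laplacian w *m v^T) 0 0.
Proof.
move=> w0 v; rewrite mulmx_sumr mulmx_suml summxE sumr_ge0 // => p _ /=.
rewrite -scalemxAr -scalemxAl mxE mulr_ge0 // mulmxA -(mulmxA (v *m _)) -trmx_mul.
by rewrite mxE big_ord1 [X in _ * X]mxE -expr2 sqr_ge0.
Qed.

Lemma mxtrace_laplacian (R : realType) n (adj : rel 'I_n)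
    (w : {ffun edge adj -> R}) :
  \tr (laplacian w) = (\sum_p w p) *+ 2.
Proof.
rewrite raddf_sum -sumrMnl; apply: eq_bigr => p _ /=.
have /andP[ltp _] := valP p.
have nep : ((val p).1 == (val p).2) = false by rewrite -val_eqE ltn_eqF.
(* By cyclicity, the trace of [d d^T] is the scalar [d^T d], which is 2 because the endpoints
   differ. *)
rewrite mxtraceZ mxtrace_mulC /mxtrace big_ord1.
rewrite [(_ - _)^T]linearB /= !trmx_delta mulmxBr !mulmxBl !mul_delta_mx_cond.
rewrite !eqxx nep [_.2 == _.1]eq_sym nep !mulr0n !mulr1n subr0 sub0r opprK.
by rewrite !mxE !eqxx -mulr2n mulr_natr.
Qed.

Lemma sorted_sum_drop_gt0 (R : realDomainType) (s : seq R) m :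
  sorted <=%R s -> (forall x, x \in s -> 0 <= x) -> (m < size s)%N ->
  0 < \sum_(x <- s) x -> 0 < \sum_(x <- drop m s) x.
Proof.
move=> s_sorted s0 ms sum0.
have sz0 : (0 < size s)%N by apply: leq_ltn_trans ms.
(* The last entry [t] is the largest: were it nonpositive, the whole sum would be. It survives the
   drop because [m < size s]. *)
pose t := nth 0 s (size s).-1.
have t0 : 0 < t.
  rewrite ltNge; apply/negP => t0; move: sum0; rewrite ltNge => /negP; apply.
  rewrite big_seq; apply: sumr_le0 => x /(nthP 0)[i si <-].
  apply: le_trans t0; apply: (sorted_leq_nth le_trans lexx) => //.
  - by rewrite inE prednK.
  - by rewrite -ltnS prednK.
have td : t \in drop m s.
  rewrite /t -(subnKC (_ : m <= (size s).-1)%N); last by rewrite -ltnS prednK.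
  rewrite -nth_drop mem_nth // size_drop ltn_sub2r //.
  by rewrite prednK.
rewrite (big_rem t td) /= ltr_wpDr // big_seq sumr_ge0 // => x /mem_rem xd.
by apply/s0/(mem_drop xd).
Qed.

Lemma eigsum_gt0 (R : realType) n (adj : rel 'I_n) k
    (w : {ffun edge adj -> R}) :
  (1 <= k <= n - 1)%N -> nonneg w -> 0 < \sum_p w p -> 0 < eigsum k w.
Proof.
(* Merging [behead] with the drop removes [n - k] entries of the full spectrum, fewer than [n] since
   [k >= 1]. *)
move=> /andP[k0 kn] w0 sw; rewrite /eigsum -drop1 drop_drop.
have Lsym := trmx_laplacian w.
have [[s_sorted _] sz] := spectrumP Lsym.
apply: sorted_sum_drop_gt0 => //.
- exact/spectrum_ge0/laplacian_psd.
- by rewrite sz; lia.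
- by rewrite sum_spectrum // mxtrace_laplacian pmulrn_lgt0.
Qed.

Lemma dotE_all_ones (R : realType) n (adj : rel 'I_n)
    (w : {ffun edge adj -> R}) : dotE (all_ones R adj) w = \sum_p w p.
Proof. by apply: eq_bigr => p _; rewrite ffunE mul1r. Qed.

Lemma sum_all_ones (R : realType) n (adj : rel 'I_n) :
  \sum_p all_ones R adj p = #|{: edge adj}|%:R.
Proof. by under eq_bigr do rewrite ffunE; rewrite sumr_const. Qed.

Lemma card_edge_gt0 n (adj : rel 'I_n) :
  symmetric adj -> irreflexive adj -> (exists a b, adj a b) ->
  (0 < #|{: edge adj}|)%N.
Proof.
move=> adj_sym adj_irr [a [b ab]].
suff [p pP] : exists p : 'I_n * 'I_n, (p.1 < p.2)%N && adj p.1 p.2.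
  by apply/card_gt0P; exists (exist _ p pP).
have [lt_ab|lt_ba|/val_inj eq_ab] := ltngtP a b.
- by exists (a, b); rewrite /= lt_ab.
- by exists (b, a); rewrite /= lt_ba adj_sym.
- by rewrite eq_ab adj_irr in ab.
Qed.

Lemma is_max_inj (R : realType) (A : set R) x y :
  is_max A x -> is_max A y -> x = y.
Proof. by move=> [Ax xub] [Ay yub]; apply/le_anti; rewrite yub // xub. Qed.

Unset Implicit Arguments.
Set Strict Implicit.

Theorem mainTheorem17 (R : realType) (n : nat) (adj : rel 'I_n)
    (adj_sym : symmetric adj) (adj_irr : irreflexive adj)
    (adj_conn : forall a b : 'I_n, connect adj a b)
    (adj_edge : exists a b : 'I_n, adj a b)
    (k : nat) (hk : (1 <= k <= n - 1)%N) :
  upper_conformally_rigid R adj k <->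
  eigsum k (all_ones R adj) * dual_gauge k (all_ones R adj) =
    #|{: edge adj}|%:R.
Proof.
set one := all_ones R adj; set E : R := #|{: edge adj}|%:R.
have E0 : 0 < E by rewrite ltr0n; apply: card_edge_gt0.
have one0 : nonneg one by move=> p; rewrite ffunE.
have S0 : 0 < eigsum k one by apply: eigsum_gt0; rewrite // sum_all_ones.
have sum_scale c (w : {ffun edge adj -> R}) :
    \sum_p [ffun p => c * w p] p = c * \sum_p w p.
  by under eq_bigr do rewrite ffunE; rewrite mulr_sumr.
have nonneg_scale c (w : {ffun edge adj -> R}) :
    0 < c -> nonneg w -> nonneg [ffun p => c * w p].
  by move=> c0 w0 p; rewrite ffunE mulr_ge0 // ltW.
split=> [rigid|gaugeE].
- suff -> : dual_gauge k one = (eigsum k one)^-1 * E.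
    by rewrite mulrA divff ?mul1r // gt_eqF.
  have max1 : is_max
      [set dotE one w | w in [set w | nonneg w /\ eigsum k w <= 1]]%classic
      ((eigsum k one)^-1 * E).
    split=> /=.
      exists [ffun p => (eigsum k one)^-1 * one p].
        split; first by apply: nonneg_scale; rewrite ?invr_gt0.
        by rewrite eigsum_scale ?invr_gt0 // mulVf // gt_eqF.
      by rewrite dotE_all_ones sum_scale sum_all_ones.
    move=> _ /= [w [w0 Sw] <-]; rewrite dotE_all_ones.
    (* A weight of total 0 cannot be rescaled into the simplex, but satisfies the bound
       trivially. *)
    have [sw|sw] := lerP (\sum_p w p) 0.
      by apply: le_trans sw _; rewrite mulr_ge0 ?invr_ge0 ?ltW.
    have c0 : 0 < E / \sum_p w p by rewrite divr_gt0.
    have /rigid : weight_simplex [ffun p => E / (\sum_p w p) * w p].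
      split; first exact: nonneg_scale.
      by rewrite dotE_all_ones sum_scale mulfVK // gt_eqF.
    rewrite eigsum_scale // => le_S.
    (* Here the constraint [eigsum k w <= 1] absorbs the second factor. *)
    have {}le_S : eigsum k one <= E / \sum_p w p.
      by apply: le_trans le_S _; rewrite ler_piMr // ltW.
    by rewrite mulrC ler_pdivlMr // mulrC -ler_pdivlMr.
  by apply: (is_max_inj _ max1); apply: xgetPex; exists ((eigsum k one)^-1 * E).
- move=> w [w0]; rewrite dotE_all_ones => sw.
  move: gaugeE; rewrite /dual_gauge; case: xgetP => [m _ [_ mub]|_]; last first.
    by move=> /eqP; rewrite mulr0 eq_sym gt_eqF.
  move=> mE.
  have Sw0 : 0 < eigsum k w by apply: eigsum_gt0; rewrite // sw.
  have : (eigsum k w)^-1 * E <= m.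
    apply: mub; exists [ffun p => (eigsum k w)^-1 * w p].
      split; first by apply: nonneg_scale; rewrite ?invr_gt0.
      by rewrite eigsum_scale ?invr_gt0 // mulVf // gt_eqF.
    by rewrite dotE_all_ones sum_scale sw.
  have m0 : 0 < m by rewrite -(pmulr_rgt0 _ S0) mE.
  (* The bound reads [E <= eigsum k w * m]; replacing [E] by [eigsum k one * m] and cancelling
     [m > 0] gives rigidity. *)
  by rewrite ler_pdivrMl // -[X in X <= _]mE ler_pM2r.
Qed.
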